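(* Let $p>3$ be a prime and let $G$ be the Gupta-Sidki $p$-group. Then the Nielsen graph $\Gamma_2(G)$ has at least $\frac{p-1}{2}$ connected components.
   Context: For an odd prime $p$, the Gupta-Sidki $p$-group is the group $\langle a,b\rangle$ of automorphisms of the rooted $p$-regular tree (bijections of the set of finite words over $\{0,1,\dots,p-1\}$) generated by $a,b$, both fixing the empty word and given recursively, for every finite word $w$, by: $a(xw)=x'w$ where $x'\equiv x+1 \pmod p$; $b(0w)=0\,a(w)$, $b(1w)=1\,a^{-1}(w)$, $b(xw)=xw$ for $2\le x\le p-2$, and $b((p-1)w)=(p-1)\,b(w)$. For a finitely generated group $G$ and $n\ge \operatorname{rank}(G)$ (the minimal number of generators), the Nielsen graph $\Gamma_n(G)$ has as vertices the generating $n$-tuples $(g_1,\dots,g_n)\in G^n$, $\langle g_1,\dots,g_n\rangle=G$; two vertices are joined by an edge if one is obtained from the other by an elementary Nielsen move, i.e. by replacing $x_i$ by $x_ix_j^{\pm1}$ or by $x_j^{\pm1}x_i$ for some $j\ne i$, or by replacing $x_j$ by $x_j^{-1}$, the other entries being unchanged. *)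

(* Defs.v *)
From HB Require Import structures.
From mathcomp Require Import all_boot.
From mathcomp Require Import boolp classical_sets functions cardinality.
From Stdlib Require Import Relations.Relation_Operators.

Set Implicit Arguments.
Unset Strict Implicit.
Unset Printing Implicit Defensive.

Local Open Scope group_scope.
Local Open Scope classical_set_scope.
Local Open Scope card_scope.

(* Automorphisms of the rooted p-regular tree: its vertices are the finite
   words over 'I_p, rooted at the empty word, ordered by the prefix relation. *)
Record tree_aut (p : nat) := TreeAut {
  tree_fun :> seq 'I_p -> seq 'I_p;
  tree_inv : seq 'I_p -> seq 'I_p;
  tree_funK : cancel tree_fun tree_inv;
  tree_invK : cancel tree_inv tree_fun;
  tree_prefix : forall u v, prefix (tree_fun u) (tree_fun v) = prefix u v }.

Lemma tree_autP (p : nat) (f g : tree_aut p) : f =1 g -> f = g.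
Proof.
case: f g => [f f' fK f'K fp] [g g' gK g'K gp] /= /funext fg.
rewrite {}fg in fK f'K fp *.
have fg' : f' = g' by apply: funext => w; rewrite -[in LHS](g'K w) fK.
rewrite {}fg' in fK f'K *.
by congr TreeAut; apply: Prop_irrelevance.
Qed.

HB.instance Definition _ (p : nat) := gen_eqMixin (tree_aut p).
HB.instance Definition _ (p : nat) := gen_choiceMixin (tree_aut p).

Definition tree_one (p : nat) : tree_aut p :=
  @TreeAut p id id (fun=> erefl) (fun=> erefl) (fun _ _ => erefl).

(* Automorphisms act on words from the left. *)
Definition tree_mul (p : nat) (f g : tree_aut p) : tree_aut p :=
  @TreeAut p (f \o g) (tree_inv g \o tree_inv f)
    (can_comp (tree_funK f) (tree_funK g))
    (can_comp (tree_invK g) (tree_invK f))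
    (fun u v => etrans (tree_prefix f (g u) (g v)) (tree_prefix g u v)).

Lemma tree_inv_prefix (p : nat) (f : tree_aut p) (u v : seq 'I_p) :
  prefix (tree_inv f u) (tree_inv f v) = prefix u v.
Proof. by rewrite -(tree_prefix f) !tree_invK. Qed.

Definition tree_invg (p : nat) (f : tree_aut p) : tree_aut p :=
  @TreeAut p (tree_inv f) f (tree_invK f) (tree_funK f) (tree_inv_prefix f).

Lemma tree_mulA (p : nat) : associative (@tree_mul p).
Proof. by move=> f g h; apply: tree_autP. Qed.

Lemma tree_mul1 (p : nat) : left_id (tree_one p) (@tree_mul p).
Proof. by move=> f; apply: tree_autP. Qed.

Lemma tree_mulr1 (p : nat) : right_id (tree_one p) (@tree_mul p).
Proof. by move=> f; apply: tree_autP. Qed.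

Lemma tree_mulV (p : nat) :
  left_inverse (tree_one p) (@tree_invg p) (@tree_mul p).
Proof. by move=> f; apply: tree_autP => w; apply: tree_funK. Qed.

Lemma tree_mulrV (p : nat) :
  right_inverse (tree_one p) (@tree_invg p) (@tree_mul p).
Proof. by move=> f; apply: tree_autP => w; apply: tree_invK. Qed.

HB.instance Definition _ (p : nat) := isGroup.Build (tree_aut p)
  (@tree_mulA p) (@tree_mul1 p) (@tree_mulr1 p)
  (@tree_mulV p) (@tree_mulrV p).

Section GuptaSidki.
Variable p : nat.
Implicit Types w u v : seq 'I_p.

Definition gs_a_fun w : seq 'I_p :=
  if w is x :: v then ordS x :: v else [::].

Definition gs_a_inv w : seq 'I_p :=
  if w is x :: v then ord_pred x :: v else [::].

Lemma gs_a_funK : cancel gs_a_fun gs_a_inv.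
Proof. by case=> //= x w; rewrite ordSK. Qed.

Lemma gs_a_invK : cancel gs_a_inv gs_a_fun.
Proof. by case=> //= x w; rewrite ord_predK. Qed.

Lemma gs_a_prefix u v : prefix (gs_a_fun u) (gs_a_fun v) = prefix u v.
Proof.
case: u v => [|x u] [|y v] //; rewrite /gs_a_fun !prefix_cons.
by rewrite (inj_eq (@ordS_inj p)).
Qed.

Definition gs_a : tree_aut p := TreeAut gs_a_funK gs_a_invK gs_a_prefix.

Fixpoint gs_b_fun w : seq 'I_p :=
  if w is x :: v then
    x :: (if x == 0%N :> nat then gs_a v
          else if x == 1%N :> nat then gs_a^-1 v
          else if x == p.-1 :> nat then gs_b_fun v
          else v)
  else [::].

Fixpoint gs_b_inv w : seq 'I_p :=
  if w is x :: v then
    x :: (if x == 0%N :> nat then gs_a^-1 v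
          else if x == 1%N :> nat then gs_a v
          else if x == p.-1 :> nat then gs_b_inv v
          else v)
  else [::].

Lemma gs_b_funK : cancel gs_b_fun gs_b_inv.
Proof.
elim=> //= x w IHw; congr cons; case: eqP => _; first exact: gs_a_funK.
case: eqP => _; first exact: gs_a_invK.
by case: eqP.
Qed.

Lemma gs_b_invK : cancel gs_b_inv gs_b_fun.
Proof.
elim=> //= x w IHw; congr cons; case: eqP => _; first exact: gs_a_invK.
case: eqP => _; first exact: gs_a_funK.
by case: eqP.
Qed.

Lemma gs_b_prefix u v : prefix (gs_b_fun u) (gs_b_fun v) = prefix u v.
Proof.
elim: u v => [|x u IHu] [|y v] //.
rewrite [gs_b_fun _]/= [in X in prefix _ X]/= !prefix_cons.
case: (x =P y) => //= <-.
case: eqP => _; first exact: gs_a_prefix.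
case: eqP => _; first exact: (tree_prefix gs_a^-1).
by case: eqP.
Qed.

Definition gs_b : tree_aut p := TreeAut gs_b_funK gs_b_invK gs_b_prefix.

End GuptaSidki.

Definition generated (gT : groupType) (A : set gT) : set gT :=
  smallest (fun H : set gT => group_closed (mem H)) A.

Definition gupta_sidki (p : nat) : set (tree_aut p) :=
  generated [set gs_a p; gs_b p].

Arguments gupta_sidki : clear implicits.

Section NielsenGraph.
Variables (gT : groupType) (n : nat).
Implicit Types u v : {ffun 'I_n -> gT}.

Definition subst_entry v (i : 'I_n) (x : gT) : {ffun 'I_n -> gT} :=
  [ffun k => if k == i then x else v k].

Inductive nielsen_move v : {ffun 'I_n -> gT} -> Prop :=
| NielsenMulR i j of j != i : nielsen_move v (subst_entry v i (v i * v j))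
| NielsenMulRV i j of j != i : nielsen_move v (subst_entry v i (v i * (v j)^-1))
| NielsenMulL i j of j != i : nielsen_move v (subst_entry v i (v j * v i))
| NielsenMulLV i j of j != i : nielsen_move v (subst_entry v i ((v j)^-1 * v i))
| NielsenInv j : nielsen_move v (subst_entry v j (v j)^-1).

Variable G : set gT.

Definition nielsen_vertex : set {ffun 'I_n -> gT} :=
  [set v | generated (range v) = G].

Definition nielsen_edge u v : Prop :=
  [/\ nielsen_vertex u, nielsen_vertex v & nielsen_move u v \/ nielsen_move v u].

Definition nielsen_component u : set {ffun 'I_n -> gT} :=
  [set v | clos_refl_trans _ nielsen_edge u v].

Definition nielsen_components : set (set {ffun 'I_n -> gT}) :=
  nielsen_component @` nielsen_vertex.

End NielsenGraph.

Arguments nielsen_components {gT} n G.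

(* Main.v *)
(** [G] maps onto its abelianization [(Z/p)^2], in which the images of [a] and
    [b] form a basis.  The determinant of the image of a generating pair is multiplied by
    [1] or [-1] under each elementary Nielsen move, so up to sign it is an
    invariant of the component.  The pairs [(a^i, b)], [0 < i <= (p-1)/2],
    generate [G] because [a] has order [p], and their determinants are pairwise
    distinct up to sign.

    The two coordinates are read off the action on words of length 2, which
    every element [g] of [G] maps by [xy |-> (x + k)(y + s_x)] with
    [\sum_x s_x = 0]: the [a]-coordinate is [k], and the [b]-coordinate is
    [- \sum_x x s_x], additive because shifting the indices of [s] changes it
    only by a multiple of [\sum_x s_x]. *)
Require Import Defs.
From mathcomp Require Import all_boot all_algebra.
From mathcomp Require Import ring zify.
From mathcomp Require Import boolp classical_sets functions cardinality.

Set Implicit Arguments.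
Unset Strict Implicit.
Unset Printing Implicit Defensive.

Import GRing.Theory.

Lemma group_closed_generated (gT : groupType) (A : set gT) :
  group_closed (mem (generated A)).
Proof.
split=> [|u v]; first by rewrite inE => H [[+ _] _]; rewrite inE.
rewrite !inE => Au Av H HA; move: (HA) => [[_ +] _] => /(_ u v).
by rewrite !inE; apply; [apply: Au | apply: Av].
Qed.

Lemma generatedX (gT : groupType) (A : set gT) (x : gT) (k : nat) :
  generated A x -> generated A (x ^+ k)%g.
Proof.
have [A1 AB] := group_closed_generated A.
have AM := group_closedM (conj A1 AB).
move=> Ax; elim: k => [|k IHk]; first by rewrite expg0; rewrite inE in A1.
by rewrite expgS; move: (AM x (x ^+ k)%g); rewrite !inE; apply.
Qed.

Section WordsOfLength2.
Variable n : nat.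
Local Notation aut := (tree_aut n.+2).
Implicit Types (g h : aut) (x y : 'I_n.+2).
Local Open Scope ring_scope.

(** Letters ['I_n.+2] carry the ring structure of Z/(n+2). A shift sends the letter [0] to the shift
    amount itself, so both rotations are read off at [0]. *)
Definition root_rot g : 'I_n.+2 := head 0 (g [:: 0; 0]).
Definition section_rot g x : 'I_n.+2 := nth 0 (g [:: x; 0]) 1.

Definition balanced g :=
  (forall x y, g [:: x; y] = [:: x + root_rot g; y + section_rot g x]) /\
  \sum_x section_rot g x = 0.

(* Minus the [b]-coordinate. *)
Definition moment g : 'I_n.+2 := \sum_x x * section_rot g x.

Lemma rotE g (k : 'I_n.+2) (s : 'I_n.+2 -> 'I_n.+2) :
    (forall x y, g [:: x; y] = [:: x + k; y + s x]) ->
  root_rot g = k /\ section_rot g =1 s.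
Proof.
by move=> gE; rewrite /root_rot /section_rot; split=> [|x]; rewrite gE /= add0r.
Qed.

Lemma balancedP g (k : 'I_n.+2) (s : 'I_n.+2 -> 'I_n.+2) :
    (forall x y, g [:: x; y] = [:: x + k; y + s x]) -> \sum_x s x = 0 ->
  balanced g.
Proof.
move=> gE s0; have [gk gs] := rotE gE.
split=> [x y|]; first by rewrite gk gs gE.
by rewrite -[RHS]s0; apply: eq_bigr => x _; rewrite gs.
Qed.

Lemma sum_shift (k : 'I_n.+2) (F : 'I_n.+2 -> 'I_n.+2) :
  \sum_x F (x + k) = \sum_x F x.
Proof.
rewrite [RHS](reindex_inj (addIr k)).
by apply: eq_bigr.
Qed.

Lemma balanced1 : balanced 1%g.
Proof.
apply: (@balancedP _ 0 (fun=> 0)); last by rewrite big1.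
by move=> x y; rewrite !addr0.
Qed.

(** [h] acts first, so the section of [g] is taken at the letter already rotated by [h]. *)
Lemma mul_rotE g h : balanced g -> balanced h -> forall x y,
  (g * h)%g [:: x; y] =
  [:: x + (root_rot g + root_rot h);
      y + (section_rot g (x + root_rot h) + section_rot h x)].
Proof.
move=> [gE _] [hE _] x y; rewrite -[LHS]/(g (h [:: x; y])) hE gE.
by congr [:: _; _]; ring.
Qed.

Lemma inv_rotE g : balanced g -> forall x y,
  (g^-1)%g [:: x; y] =
  [:: x + - root_rot g; y + - section_rot g (x - root_rot g)].
Proof.
move=> [gE _] x y; apply: (can_inj (tree_funK g)).
rewrite -[LHS]/(g (tree_inv g _)) tree_invK gE.
by congr [:: _; _]; ring.
Qed.

Lemma balancedM g h : balanced g -> balanced h -> balanced (g * h)%g.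
Proof.
move=> gB hB; apply: (balancedP (mul_rotE gB hB)).
by rewrite big_split /= (sum_shift _ (section_rot g)) gB.2 hB.2 addr0.
Qed.

Lemma balancedV g : balanced g -> balanced (g^-1)%g.
Proof.
move=> gB; apply: (balancedP (inv_rotE gB)).
by rewrite sumrN (sum_shift _ (section_rot g)) gB.2 oppr0.
Qed.

Lemma root_rotM g h : balanced g -> balanced h ->
  root_rot (g * h)%g = root_rot g + root_rot h.
Proof. by move=> gB hB; have [] := rotE (mul_rotE gB hB). Qed.

Lemma root_rotV g : balanced g -> root_rot (g^-1)%g = - root_rot g.
Proof. by move=> gB; have [] := rotE (inv_rotE gB). Qed.

(** Reindexing leaves a correction [k * \sum_x section_rot g x], which is zero by balance. This
    absorbs the index shift occurring in products and inverses. *)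
Lemma moment_shift g (k : 'I_n.+2) : balanced g ->
  \sum_x x * section_rot g (x + k) = moment g.
Proof.
move=> [_ g0]; transitivity (\sum_x (x - k) * section_rot g x).
  by rewrite -[RHS](sum_shift k); apply: eq_bigr => x _; rewrite addrK.
under eq_bigr do rewrite mulrBl.
by rewrite sumrB -mulr_sumr g0 mulr0 subr0.
Qed.

Lemma momentM g h : balanced g -> balanced h ->
  moment (g * h)%g = moment g + moment h.
Proof.
move=> gB hB; have [_ ghE] := rotE (mul_rotE gB hB).
rewrite -(moment_shift (root_rot h) gB) -big_split.
by apply: eq_bigr => x _; rewrite ghE mulrDr.
Qed.

Lemma momentV g : balanced g -> moment (g^-1)%g = - moment g.
Proof.
move=> gB; have [_ gE] := rotE (inv_rotE gB).
rewrite -(moment_shift (- root_rot g) gB) -sumrN.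
by apply: eq_bigr => x _; rewrite gE mulrN.
Qed.

Lemma ordSE x : ordS x = x + 1.
Proof. by apply: val_inj; rewrite /= modnDmr addn1. Qed.

Lemma ord_predE x : ord_pred x = x - 1.
Proof. by apply: (@ordS_inj n.+2); rewrite ord_predK ordSE subrK. Qed.

Lemma gs_aE x y : gs_a n.+2 [:: x; y] = [:: x + 1; y + 0].
Proof. by rewrite /= ordSE addr0. Qed.

Lemma gs_bE x y : gs_b n.+2 [:: x; y] =
  [:: x + 0; y + (if x == 0 then 1 else if x == 1 then - 1 else 0)].
Proof.
rewrite /= addr0 -!val_eqE /=; case: eqP => _; first by rewrite ordSE.
case: eqP => _; first by rewrite ord_predE.
(* At the last letter the section is [gs_b] itself, which fixes words of length 1, so this branch
   agrees with the identity branch. *)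
by rewrite addr0 !if_same.
Qed.

Lemma balanced_a : balanced (gs_a n.+2).
Proof. by apply: (balancedP gs_aE); rewrite big1. Qed.

Lemma balanced_b : balanced (gs_b n.+2).
Proof.
apply: (balancedP gs_bE).
rewrite (bigD1 0) //= (bigD1 1) //= big1 ?addr0 ?subrr // => x.
by case/andP=> /negPf-> /negPf->.
Qed.

Lemma gupta_sidki_balanced g : gupta_sidki n.+2 g -> balanced g.
Proof.
apply: (smallest_sub (X := balanced)) => [|_ [->|->]]; last exact: balanced_b.
  split=> [|u v]; rewrite !inE; first exact: balanced1.
  by move=> uB /balancedV; apply: balancedM.
exact: balanced_a.
Qed.

Lemma root_rot_b : root_rot (gs_b n.+2) = 0.
Proof. by have [] := rotE gs_bE. Qed.

Lemma moment_b : moment (gs_b n.+2) = - 1.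
Proof.
(* The rotation at letter [0] has weight [0], so only letter [1] contributes. *)
have [_ bE] := rotE gs_bE; rewrite /moment (bigD1 1) //= bE mul1r /=.
rewrite big1 ?addr0 // => x /negPf x1; rewrite bE x1.
by case: eqP => [->|_]; rewrite ?mul0r ?mulr0.
Qed.

Lemma gs_aX_word k x (w : seq 'I_n.+2) :
  (gs_a n.+2 ^+ k)%g (x :: w) = x + k%:R :: w.
Proof.
elim: k => [|k IHk]; first by rewrite addr0.
rewrite expgS -[LHS]/(gs_a n.+2 ((gs_a n.+2 ^+ k)%g (x :: w))) IHk /=.
by rewrite ordSE -addrA natr1.
Qed.

Lemma root_rot_aX k : root_rot (gs_a n.+2 ^+ k)%g = k%:R.
Proof. by rewrite /root_rot gs_aX_word /= add0r. Qed.

Lemma gs_aX_nil k : (gs_a n.+2 ^+ k)%g [::] = [::].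
Proof.
elim: k => [|k IHk] //.
by rewrite expgS -[LHS]/(gs_a n.+2 ((gs_a n.+2 ^+ k)%g [::])) IHk.
Qed.

Lemma gs_aX_mod k m : k = m %[mod n.+2] ->
  (gs_a n.+2 ^+ k = gs_a n.+2 ^+ m)%g.
Proof.
move=> km; apply: tree_autP => -[|x w]; first by rewrite !gs_aX_nil.
rewrite !gs_aX_word; congr (_ + _ :: _).
by apply: val_inj; rewrite !Zp_nat /= km.
Qed.

(** Minus the determinant in the coordinates of the abelianization, because [moment] is minus the
    [b]-coordinate. *)
Definition pair_det (v : {ffun 'I_2 -> aut}) : 'I_n.+2 :=
  root_rot (v 0) * moment (v 1) - root_rot (v 1) * moment (v 0).

Lemma nielsen_move_det (u v : {ffun 'I_2 -> aut}) :
    (forall i, balanced (u i)) -> nielsen_move u v ->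
  pair_det v = pair_det u \/ pair_det v = - pair_det u.
Proof.
move=> uB; have I2P (i : 'I_2) : i = 0 \/ i = 1.
  by case: i => [[|[|]]] // ?; [left | right]; apply: val_inj.
rewrite /pair_det => -[i j|i j|i j|i j|j]; last first.
  by case: (I2P j) => ->; rewrite !ffunE /= root_rotV // momentV //; right; ring.
(* The other moves add or subtract one row to or from the other; left and right multiplication agree
   on the additive coordinates. *)
all: case: (I2P i) => ->; case: (I2P j) => -> //= _; rewrite !ffunE /=.
all: rewrite root_rotM ?momentM ?root_rotV ?momentV //; try exact: balancedV.
all: by left; ring.
Qed.

Lemma nielsen_component_det (u v : {ffun 'I_2 -> aut}) :
    nielsen_component (gupta_sidki n.+2) u v ->
  pair_det v = pair_det u \/ pair_det v = - pair_det u.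
Proof.
have vertex_balanced (w : {ffun 'I_2 -> aut}) i :
    nielsen_vertex (gupta_sidki n.+2) w -> balanced (w i).
  move=> wG; apply: gupta_sidki_balanced; rewrite -wG.
  by apply: sub_gen_smallest; exists i.
elim=> [x y [xG yG [xy|yx]]|x|x y z _ IHxy _ IHyz]; last 2 first.
- by left.
- by case: IHxy IHyz => [<- //|Dy] [->|->]; [right | left]; rewrite ?Dy ?opprK.
- by apply: nielsen_move_det => // i; apply: vertex_balanced.
(* An edge may come from a move in the opposite direction; equality up to sign is symmetric. *)
case: (nielsen_move_det (fun i => vertex_balanced y i yG) yx) => ->; first by left.
by right; rewrite opprK.
Qed.

Definition aX_b_pair k : {ffun 'I_2 -> aut} :=
  [ffun i : 'I_2 => if i == 0 then (gs_a n.+2 ^+ k)%g else gs_b n.+2].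

Lemma pair_det_aX_b k : pair_det (aX_b_pair k) = - k%:R.
Proof.
by rewrite /pair_det !ffunE /= root_rot_aX moment_b root_rot_b mul0r subr0 mulrN1.
Qed.

Lemma nielsen_vertex_aX_b k : coprime k n.+2 ->
  nielsen_vertex (gupta_sidki n.+2) (aX_b_pair k).
Proof.
move=> k_co; apply/seteqP; split.
  apply: smallest_sub; first exact: group_closed_generated.
  have ab_G : ([set gs_a n.+2; gs_b n.+2] `<=` gupta_sidki n.+2)%classic.
    exact: sub_gen_smallest.
  move=> _ [i _ <-]; rewrite ffunE; case: ifP => _; last by apply: ab_G; right.
  by apply: generatedX; apply: ab_G; left.
apply: smallest_sub; first exact: group_closed_generated.
have v_gen i : generated (range (aX_b_pair k)) (aX_b_pair k i).
  by apply: sub_gen_smallest; exists i.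
move=> _ [->|->]; last by have := v_gen 1; rewrite ffunE.
have k_gt0 : (0 < k)%N by case: k k_co {v_gen}; rewrite // coprime0n.
(* Bézout gives [u * k] congruent to 1 modulo [n.+2], so [gs_a] is a power of [gs_a ^+ k]. *)
case: (egcdnP n.+2 k_gt0) => u m ukE _.
have -> : (gs_a n.+2 = (gs_a n.+2 ^+ k) ^+ u)%g.
  rewrite -expgnA -[LHS]expg1; apply: gs_aX_mod.
  by rewrite mulnC ukE (eqP k_co) modnMDl.
by apply: generatedX; have := v_gen 0; rewrite ffunE.
Qed.

End WordsOfLength2.

Theorem corollary1p5 (p : nat) (hp : prime p) (hp3 : 3 < p) :
  (`I_((p - 1) %/ 2) #<= nielsen_components 2 (gupta_sidki p))%card.
Proof.
case: p hp hp3 => [|[|n]] // hp hp3.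
(* Indices start at 0, exponents at 1. *)
pose f i := nielsen_component (gupta_sidki n.+2) (aX_b_pair n i.+1).
suff f_inj : {in `I_((n.+2 - 1) %/ 2) &, injective f}.
  rewrite -(card_le_eql (inj_card_eq f_inj)); apply: subset_card_le.
  move=> _ [i /= lt_i <-]; exists (aX_b_pair n i.+1) => //.
  apply: nielsen_vertex_aX_b; rewrite coprime_sym prime_coprime //.
  by rewrite gtnNdvd //; lia.
move=> i j; rewrite !inE /= => lt_i lt_j fij.
have /nielsen_component_det : f i (aX_b_pair n j.+1).
  by rewrite fij; apply: Relation_Operators.rt_refl.
rewrite !pair_det_aX_b => -[/oppr_inj/(congr1 val)|/oppr_inj].
  by rewrite !Zp_nat /= !modn_small; lia.
(* Opposite determinants would make the sum of the exponents vanish modulo p, but it lies between 2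
   and p - 1. *)
move/eqP; rewrite -subr_eq0 opprK -natrD => /eqP/(congr1 val).
by rewrite !Zp_nat /= modn_small; lia.
Qed.
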